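(* Let $(X,\mathcal U)$ be a uniform space. Suppose that there exists an infinite cardinal $\tau$ such that $\bigcap_{i\in I}\varepsilon_i\in\mathcal U$ for any family of entourages $\{\varepsilon_i: i\in I\}\subseteq\mathcal U$ with $|I|\le\tau$. Then: \begin{enumerate} \item The intersection of any family of cardinality at most $\tau$ of open subsets of the uniform free topological group $F(X,\mathcal U)$ is open. In particular, $F(X,\mathcal U)$ is a $P$-group, and $F(X,\mathcal U)=F_{\mathcal{NA}}(X,\mathcal U)$. \item If the uniform space $(X,\mathcal U)$ is also $\tau$-narrow, then $F(X,\mathcal U)=F_{\mathcal{NA}}(X,\mathcal U)=F^b_{\mathcal{NA}}(X,\mathcal U)$. \end{enumerate}
   Context: All topological groups and uniform spaces are assumed to be Hausdorff, and $X$ is nonempty. A $P$-group is a topological group in which the intersection of countably many open sets is open. A uniform space $(X,\mathcal U)$ is $\tau$-narrow if for every $\varepsilon\in\mathcal U$ there is a set $\{x_\alpha:\alpha<\tau\}\subseteq X$ with $X=\bigcup_{\alpha<\tau}\varepsilon[x_\alpha]$, where $\varepsilon[a]=\{x\in X:(a,x)\in\varepsilon\}$. A topological group is non-archimedean if it has a local base at the identity consisting of open subgroups; it is balanced if its left uniformity (base: $\{(x,y): x^{-1}y\in U\}$) and right uniformity (base: $\{(x,y): xy^{-1}\in U\}$), $U$ running over neighborhoods of the identity, coincide. A uniform space is non-archimedean if its uniformity has a base of equivalence relations; a uniform space satisfying the hypothesis of the claim is non-archimedean. For a class $\Omega$ of topological groups and a uniform space $(X,\mathcal U)$, the $\Omega$-free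 topological group of $(X,\mathcal U)$ is a pair $(F_\Omega(X,\mathcal U),i)$ with $F_\Omega(X,\mathcal U)\in\Omega$ and $i:X\to F_\Omega(X,\mathcal U)$ uniformly continuous, such that for every $G\in\Omega$ and every uniformly continuous $\varphi:(X,\mathcal U)\to G$ there is a unique continuous homomorphism $\Phi:F_\Omega(X,\mathcal U)\to G$ with $\Phi\circ i=\varphi$. Topological groups carry here their two-sided uniformity (the supremum of the left and right uniformities). The uniform free topological group $F(X,\mathcal U)$ is the case where $\Omega$ is the class of all topological groups. For $(X,\mathcal U)$ non-archimedean, $F_{\mathcal{NA}}(X,\mathcal U)$ (free non-archimedean group) is the case where $\Omega$ is the class of non-archimedean groups, and $F^b_{\mathcal{NA}}(X,\mathcal U)$ (free non-archimedean balanced group) is the case where $\Omega$ is the class of non-archimedean balanced groups. It is known that these groups exist and that algebraically each is the free group $F(X)$ on $X$ (identified with $i(X)$), so each is given by a group topology on $F(X)$. Equality between them means that these topologies coincide, i.e. the canonical continuous homomorphisms between them extending the identity of $X$ are topological isomorphisms. *)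

(* Defs.v *)
From HB Require Import structures.
From mathcomp Require Import all_boot all_classical topology.
Set Implicit Arguments.
Unset Strict Implicit.
Unset Printing Implicit Defensive.
Local Open Scope classical_set_scope.
Local Open Scope group_scope.

HB.mixin Record TopologicalGroup_axioms G of Group G & Topological G := {
  mulg_continuous : continuous (fun x : G * G => x.1 * x.2);
  invg_continuous : continuous (fun x : G => x^-1)
}.

#[short(type="topologicalGroupType")]
HB.structure Definition TopologicalGroup :=
  {G of TopologicalGroup_axioms G & Group G & Topological G}.

Section uniformities.
Variable G : topologicalGroupType.

Definition left_entourage : set_system (G * G) :=
  filter_from (nbhs (1 : G)) (fun U => [set xy | U (xy.1^-1 * xy.2)]).

Definition right_entourage : set_system (G * G) :=
  filter_from (nbhs (1 : G)) (fun U => [set xy | U (xy.1 * xy.2^-1)]).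

(* The supremum (join) of the filters of left and right entourages. *)
Definition two_sided_entourage : set_system (G * G) :=
  [set E | exists2 L, left_entourage L &
           exists2 R, right_entourage R & L `&` R `<=` E].

Definition balanced : Prop := left_entourage = right_entourage.

Definition nonarchimedean_group : Prop :=
  forall U : set G, nbhs (1 : G) U ->
    exists H : set G, [/\ open H, group_closed (mem H) & H `<=` U].

Definition P_group : Prop :=
  forall O : nat -> set G, (forall n, open (O n)) -> open (\bigcap_n O n).

End uniformities.

(* An alias of G whose uniform structure is the two-sided one.  Its topology
   is the original topology of G. *)
Definition two_sided (G : topologicalGroupType) : Type := G.
HB.instance Definition _ (G : topologicalGroupType) :=
  Topological.copy (two_sided G) G.

Section two_sided_uniform.
Variable G : topologicalGroupType.
Local Notation ent := (@two_sided_entourage G).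

Let nbhs_entP (E : set (G * G)) : ent E <->
  exists2 U, nbhs (1 : G) U &
    [set xy | U (xy.1^-1 * xy.2) /\ U (xy.1 * xy.2^-1)] `<=` E.
Proof.
split=> [[L [U nU UL] [R [V nV VR] LRE]]|[U nU UE]].
  exists (U `&` V); first exact: filterI.
  by move=> xy [[Ul _] [_ Vr]]; apply: LRE; split; [exact: UL|exact: VR].
exists [set xy | U (xy.1^-1 * xy.2)]; first by exists U.
exists [set xy | U (xy.1 * xy.2^-1)]; first by exists U.
exact: UE.
Qed.

Let ent_filter : Filter ent.
Proof.
split.
- by apply/nbhs_entP; exists setT => //; exact: filterT.
- move=> A B /nbhs_entP[U nU UA] /nbhs_entP[V nV VB].
  apply/nbhs_entP; exists (U `&` V); first exact: filterI.
  by move=> xy [[? ?] [? ?]]; split; [exact: UA|exact: VB].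
- move=> A B AB /nbhs_entP[U nU UA].
  by apply/nbhs_entP; exists U => // xy /UA /AB.
Qed.

Let ent_diagonal A : ent A -> diagonal `<=` A.
Proof.
move=> /nbhs_entP[U nU UA] [x y] /= xy; apply: UA => /=.
have -> : x = y by exact: xy.
by rewrite mulVg mulgV; split; exact: nbhs_singleton.
Qed.

Let ent_inv A : ent A -> ent (A^-1)%relation.
Proof.
move=> /nbhs_entP[U nU UA]; apply/nbhs_entP.
exists (U `&` [set x | U x^-1]).
  apply: filterI => //; apply: (@invg_continuous G).
  by rewrite invg1.
move=> [x y] /= [[_ +] [_ +]]; rewrite !invgM !invgK => h k.
by apply: UA.
Qed.

Let ent_split A : ent A -> exists2 B, ent B & (B \; B `<=` A)%relation.
Proof.
move=> /nbhs_entP[U nU UA].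
have : nbhs ((1, 1) : G * G) [set x | U (x.1 * x.2)].
  by apply: (@mulg_continuous G); rewrite /= mulg1.
move=> [[V W] /= [nV nW] VWU]; have nVW : nbhs (1 : G) (V `&` W).
  exact: filterI.
exists [set xy | (V `&` W) (xy.1^-1 * xy.2) /\ (V `&` W) (xy.1 * xy.2^-1)].
  by apply/nbhs_entP; exists (V `&` W).
move=> [x y] /= [z /= [[Vl _] [Vr _]] [[_ Wl] [_ Wr]]]; apply: UA => /=.
split.
  have := VWU (x^-1 * z, z^-1 * y) (conj Vl Wl).
  by rewrite /= mulgA -(mulgA x^-1) mulgV mulg1.
have := VWU (x * z^-1, z * y^-1) (conj Vr Wr).
by rewrite /= mulgA -(mulgA x) mulVg mulg1.
Qed.

Let mull_continuous (a : G) : continuous (fun x : G => a * x).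
Proof.
move=> x; apply: (@continuous_comp _ _ _ (fun x : G => (a, x))
  (fun x : G * G => x.1 * x.2)); last exact: mulg_continuous.
by apply: cvg_pair => //; exact: cvg_cst.
Qed.

Let ent_nbhs : (nbhs : two_sided G -> _) = nbhs_ ent.
Proof.
apply/funext => x; apply/seteqP; split=> [A nA|A [E /nbhs_entP[U nU UE] EA]].
  exists [set xy | xy.1 = x -> A xy.2].
    apply/nbhs_entP; exists [set u : G | A (x * u)].
      by apply: (@mull_continuous x (1 : G)); rewrite /= mulg1.
    by move=> [y z] /= [+ _] yx; rewrite yx mulgA mulgV mul1g.
  by move=> y /xsectionP; exact.
have nV : nbhs x [set y | U (x^-1 * y)].
  by apply: (@mull_continuous x^-1 x); rewrite /= mulVg.
have nW : nbhs x [set y | U (x * y^-1)].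
  apply: (@invg_continuous G x [set z | U ((x : G) * z)]).
  by apply: (@mull_continuous x (x^-1 : G)); rewrite /= mulgV.
apply: filterS (filterI nV nW) => y [Vy Wy].
by apply/EA/xsectionP; exact: UE.
Qed.

HB.instance Definition _ := Nbhs_isUniform_mixin.Build (two_sided G)
  ent_filter ent_diagonal ent_inv ent_split ent_nbhs.

End two_sided_uniform.

Section free_topological_groups.

Definition topological_isomorphism (G H : topologicalGroupType)
    (Phi : G -> H) : Prop :=
  [/\ monoid_morphism Phi, continuous Phi &
      exists Psi : H -> G, [/\ cancel Phi Psi, cancel Psi Phi & continuous Psi]].

(* (F, i) is the Omega-free topological group of X.  All topological groups
   are meant to be Hausdorff, so Omega is implicitly intersected with the class
   of Hausdorff groups. *)
Definition free_topological_group (Omega : topologicalGroupType -> Prop)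
    (X : uniformType) (F : topologicalGroupType) (i : X -> F) : Prop :=
  [/\ hausdorff_space F, Omega F,
      unif_continuous (i : X -> two_sided F) &
      forall G : topologicalGroupType, hausdorff_space G -> Omega G ->
      forall phi : X -> G, unif_continuous (phi : X -> two_sided G) ->
      exists! Phi : F -> G,
        [/\ monoid_morphism Phi, continuous Phi & Phi \o i = phi]].

Definition uniform_free_group :=
  free_topological_group (fun=> True).

Definition free_nonarchimedean_group :=
  free_topological_group nonarchimedean_group.

Definition free_nonarchimedean_balanced_group :=
  free_topological_group (fun G => nonarchimedean_group G /\ balanced G).

(* Equality of free groups: the canonical homomorphism that extends the
   identity of X is a topological isomorphism. *)
Definition same_free_group (X : uniformType) (F G : topologicalGroupType)
    (i : X -> F) (j : X -> G) : Prop :=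
  exists Phi : F -> G, topological_isomorphism Phi /\ Phi \o i = j.

End free_topological_groups.

(* The cardinal tau is represented by a type of that cardinality. *)
Definition cardinal_narrow (tau : Type) (X : uniformType) : Prop :=
  forall E : set (X * X), entourage E ->
    exists x : tau -> X, [set: X] = \bigcup_a xsection E (x a).

(* Main.v *)
(* The [tau]-modification of [F], in which intersections of [tau] many open
   sets are declared open, is a Hausdorff group topology, and [iF] stays uniformly
   continuous into it because the entourages of [X] are closed under such
   intersections.  The universal property thus makes the identity of [F]
   continuous into its [tau]-modification, so the two topologies agree.  A
   P-group is non-archimedean: iterating [V |-> W] with [W W^-1 <= V] and
   intersecting gives open subgroups.  When [X] is [tau]-narrow, an open subgroup
   [H] has only [tau] many conjugates by elements of [iF X], so intersecting them
   gives an open subgroup; after countably many steps the intersection is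
   normalized by [iF X], hence by [F], and [F] is balanced. *)
Require Import Defs.
From HB Require Import structures.
From mathcomp Require Import all_boot all_classical topology.
Local Open Scope classical_set_scope.
Local Open Scope card_scope.

Set Implicit Arguments.
Unset Strict Implicit.
Unset Printing Implicit Defensive.

Local Open Scope group_scope.

(** * Intersections of families of open sets *)

Lemma injective_hausdorff (S T : topologicalType) (f : S -> T) :
  continuous f -> injective f -> hausdorff_space T -> hausdorff_space S.
Proof.
move=> cf inj_f hT p q pq; apply/inj_f/hT => A B nA nB.
by have [x [Ax Bx]] := pq _ _ (cf p _ nA) (cf q _ nB); exists (f x).
Qed.

Lemma continuousT_comp (R S T : topologicalType) (f : R -> S) (g : S -> T) :
  continuous f -> continuous g -> continuous (g \o f).
Proof. by move=> cf cg x; exact: continuous_comp (cf x) (cg (f x)). Qed.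

Lemma nbhs_bigcap (tau : Type) (T : topologicalType) :
  (forall O : tau -> set T, (forall i, open (O i)) -> open (\bigcap_i O i)) ->
  forall (x : T) (A : tau -> set T), (forall i, nbhs x (A i)) ->
    nbhs x (\bigcap_i A i).
Proof.
move=> capO x A nA; rewrite nbhsE; exists (\bigcap_i (A i)°).
  split; first by apply: capO => i; exact: open_interior.
  by move=> i _; exact: nA.
by move=> y Ay i _; apply: interior_subset; exact: Ay.
Qed.

(** The family is reindexed along an injection [g] of [J] into [tau]. An index outside the image of
    [g] contributes the whole space, which also covers an empty [J]. *)
Lemma open_bigcap_card_le (J tau : Type) (T : topologicalType)
    (O : J -> set T) :
  (forall O : tau -> set T, (forall i, open (O i)) -> open (\bigcap_i O i)) ->
  [set: J] #<= [set: tau] -> (forall i, open (O i)) -> open (\bigcap_i O i).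
Proof.
move=> capO /card_leP[f] openO.
pose inJ (j : J) : set_type [set: J] := exist _ j (mem_set Logic.I).
pose g j : tau := val (f (inJ j)).
have inj_g : injective g.
  by move=> i j /val_inj e; have [] := inj (mem_set Logic.I) (mem_set Logic.I) e.
have -> : \bigcap_i O i = \bigcap_t [set x | forall i, g i = t -> O i x].
  apply/seteqP; split=> [x Ox t _ i _|x Ox i _]; first exact: Ox.
  exact: (Ox (g i)).
apply: capO => t; have [[i <-]|noi] := pselect (exists i, g i = t).
  suff -> : [set x | forall j, g j = g i -> O j x] = O i by [].
  by apply/seteqP; split=> x; [exact|move=> Oix j /inj_g ->].
suff -> : [set x | forall i, g i = t -> O i x] = setT by exact: openT.
by apply/seteqP; split=> // x _ i gi; case: noi; exists i.
Qed.

(** * Neighborhoods of the identity, subgroups and balance *)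

Section topological_group.
Variable G : topologicalGroupType.

Lemma nbhs_mulg (x y : G) (A : set G) : nbhs (x * y) A ->
  exists V W, [/\ nbhs x V, nbhs y W & forall v w, V v -> W w -> A (v * w)].
Proof.
move=> nA; have [[V W] /= [nV nW] VWA] := @mulg_continuous G (x, y) A nA.
by exists V, W; split=> // v w Vv Ww; apply: (VWA (v, w)).
Qed.

Lemma mulgl_continuous (a : G) : continuous (fun x : G => a * x).
Proof.
move=> x A /nbhs_mulg[V [W [nV nW VWA]]]; apply: filterS nW => w Ww.
by apply: VWA => //; exact: nbhs_singleton.
Qed.

Lemma mulgr_continuous (a : G) : continuous (fun x : G => x * a).
Proof.
move=> x A /nbhs_mulg[V [W [nV nW VWA]]]; apply: filterS nV => w Ww.
by apply: VWA => //; exact: nbhs_singleton.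
Qed.

Lemma nbhs1_conj (a : G) (A : set G) : nbhs (1 : G) A ->
  nbhs (1 : G) [set g | A (a * g * a^-1)].
Proof.
move=> nA; apply: (@mulgl_continuous a 1 [set g | A (g * a^-1)]).
by apply: (@mulgr_continuous a^-1); rewrite /= mulg1 mulgV.
Qed.

Lemma nbhs1_div (A : set G) : nbhs (1 : G) A ->
  exists2 V, nbhs (1 : G) V & forall v w, V v -> V w -> A (v * w^-1).
Proof.
rewrite -{1}(mulg1 1) => /nbhs_mulg[V [W [nV nW VWA]]].
exists (V `&` [set w | W w^-1]); last by move=> v w [Vv _] [_ Ww]; exact: VWA.
apply: filterI => //; apply: (@invg_continuous G (1 : G)).
by rewrite invg1.
Qed.

Definition subgroup (S : set G) : Prop :=
  S 1 /\ forall x y, S x -> S y -> S (x * y^-1).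

Lemma subgroup_closed S : subgroup S -> group_closed (mem S).
Proof.
move=> [S1 SD]; split; first exact/mem_set.
by move=> x y /set_mem Sx /set_mem Sy; apply/mem_set/SD.
Qed.

Lemma closed_subgroup S : group_closed (mem S) -> subgroup S.
Proof.
move=> [/set_mem S1 SD]; split=> // x y Sx Sy.
by apply/set_mem/SD; exact/mem_set.
Qed.

Lemma subgroupV S x : subgroup S -> S x -> S x^-1.
Proof. by move=> [S1 SD] Sx; have := SD _ _ S1 Sx; rewrite mul1g. Qed.

Lemma subgroupM S x y : subgroup S -> S x -> S y -> S (x * y).
Proof.
by move=> SS Sx Sy; rewrite -(invgK y); apply: SS.2 => //; exact: subgroupV.
Qed.

Lemma open_subgroup S : subgroup S -> nbhs (1 : G) S -> open S.
Proof.
move=> SS nS; rewrite openE => x Sx.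
have : nbhs x [set y | S (x^-1 * y)].
  by apply: (@mulgl_continuous x^-1 x); rewrite /= mulVg.
apply: filterS => y /= Sy; rewrite -(mulVKg x y); exact: subgroupM.
Qed.

Lemma P_group_nonarchimedean : P_group G -> nonarchimedean_group G.
Proof.
move=> PG U nU.
(* [half] is made total by the junk value [set0] at sets that are not neighborhoods of 1. *)
have /choice[half halfP] : forall V : set G, exists W : set G,
    nbhs (1 : G) V -> nbhs (1 : G) W /\
      forall v w, W v -> W w -> V (v * w^-1).
  move=> V; have [/nbhs1_div[W nW WV]|nV] := pselect (nbhs (1 : G) V).
    by exists W.
  by exists set0 => /nV.
pose W n := iter n half U.
have nW n : nbhs (1 : G) (W n) by elim: n => //= n /halfP[].
(* Quotients of elements of [W n.+1] lie in [W n], so the shift of index is absorbed by the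
   intersection. *)
have sW : subgroup (\bigcap_n W n).
  split=> [n _|x y Wx Wy n _]; first exact: nbhs_singleton.
  by apply: (halfP _ (nW n)).2; [exact: (Wx n.+1)|exact: (Wy n.+1)].
exists (\bigcap_n W n); split.
- by apply: open_subgroup => //; exact: nbhs_bigcap.
- exact: subgroup_closed.
- by move=> x Wx; exact: (Wx 0%N).
Qed.

(** Conjugation by [x] carries [x^-1 * y] to [y * x^-1], the inverse of [x * y^-1]. A
    conjugation-invariant [K] thus controls one side as soon as its inverse controls the other. *)
Lemma normal_balanced :
  (forall U : set G, nbhs (1 : G) U -> exists K : set G,
    [/\ nbhs (1 : G) K, K `<=` U & forall x y, K x -> K (y * x * y^-1)]) ->
  balanced G.
Proof.
move=> normalG; have cV (U : set G) : nbhs (1 : G) U ->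
    nbhs (1 : G) [set x | U x^-1].
  by move=> nU; apply: (@invg_continuous G (1 : G)); rewrite invg1.
apply/seteqP; split=> E [U nU UE]; have [K [nK KU Kn]] := normalG _ nU.
  exists [set x | K x^-1] => [|[x y] /= Kxy]; first exact: cV.
  apply: UE => /=; apply: KU.
  by have := Kn _ x^-1 Kxy; rewrite invgM !invgK !mulgA divgK.
exists [set x | K x^-1] => [|[x y] /= Kxy]; first exact: cV.
apply: UE => /=; apply: KU.
by have := Kn _ y Kxy; rewrite invgM !invgK !mulgA mulgV mul1g.
Qed.

End topological_group.

(** * Homomorphisms and uniformly continuous maps into groups *)

Lemma monoid_morphism_comp (G H K : groupType) (f : G -> H) (g : H -> K) :
  monoid_morphism f -> monoid_morphism g -> monoid_morphism (g \o f).
Proof.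
by move=> [f1 fM] [g1 gM]; split=> [|x y] /=; rewrite ?f1 ?fM.
Qed.

Lemma two_sided_unif_continuousP (X : uniformType) (G : topologicalGroupType)
    (f : X -> G) :
  unif_continuous (f : X -> two_sided G) <->
  forall U, nbhs (1 : G) U ->
    entourage [set xy | U ((f xy.1)^-1 * f xy.2) /\ U (f xy.1 * (f xy.2)^-1)].
Proof.
split=> [cf U nU|cf E [L [U nU UL] [R [V nV VR] LRE]]].
  apply: (cf [set xy : G * G | U (xy.1^-1 * xy.2) /\ U (xy.1 * xy.2^-1)]).
  exists [set xy | U (xy.1^-1 * xy.2)]; first by exists U.
  by exists [set xy | U (xy.1 * xy.2^-1)] => //; exists U.
apply: filterS (cf _ (filterI nU nV)) => xy /= [[Ul _] [_ Vr]].
by apply: LRE; split; [exact: UL|exact: VR].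
Qed.

(** * A subgroup as a topological group *)

Section subgroup_type.
Variables (G : topologicalGroupType) (S : set G) (subS : subgroup S).

(** The type carries the proof of [subgroup S], so that its group structure can be inferred from the
    type alone. *)
Definition subgroup_type of subgroup S : Type := {x : G | x \in S}.
Local Notation T := (subgroup_type subS).

HB.instance Definition _ := SubChoice.copy T {x : G | x \in S}.
HB.instance Definition _ :=
  @SubChoice_isSubGroup.Build G (fun x => x \in S) T (subgroup_closed subS).
HB.instance Definition _ :=
  Topological.copy T (initial_topology (val : {x : G | x \in S} -> G)).

Lemma subgroup_val_morphism : monoid_morphism (val : T -> G).
Proof. by split; [exact: (val1 T)|exact: valM]. Qed.

Lemma subgroup_val_continuous : continuous (val : T -> G).
Proof. exact: initial_continuous. Qed.

Lemma nbhs_subgroup (x : T) (A : set G) :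
  nbhs (val x) A -> nbhs x [set y : T | A (val y)].
Proof. exact: subgroup_val_continuous. Qed.

Lemma nbhs_subgroupP (x : T) (A : set T) : nbhs x A ->
  exists2 B, nbhs (val x) B & forall y : T, B (val y) -> A y.
Proof.
move=> [_ [[B oB <-] Bx BA]]; exists B; first exact: open_nbhs_nbhs.
by move=> y; exact: BA.
Qed.

Let mul_continuous : continuous (fun x : T * T => x.1 * x.2).
Proof.
move=> [x y] A /nbhs_subgroupP[B]; rewrite /=.
move=> /nbhs_mulg[V [W [nV nW VWB]]] BA.
exists ([set v | V (val v)], [set w | W (val w)]) => /=.
  by split; exact: nbhs_subgroup.
by move=> [v w] /= [Vv Ww]; apply: BA; exact: VWB.
Qed.

Lemma subgroup_valV (x : T) : val x^-1 = (val x)^-1.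
Proof. by apply: (mulIg (val x)); rewrite -(valM x^-1 x) !mulVg. Qed.

Let inv_continuous : continuous (fun x : T => x^-1).
Proof.
move=> x A /nbhs_subgroupP[B]; rewrite subgroup_valV => nB BA.
apply: filterS (nbhs_subgroup (@invg_continuous G (val x) _ nB)) => y By.
by apply: BA; rewrite subgroup_valV.
Qed.

HB.instance Definition _ :=
  TopologicalGroup_axioms.Build T mul_continuous inv_continuous.

End subgroup_type.

(* If [tau] is empty, the topology below is indiscrete instead of refining that
   of [G]. *)
Definition tau_modification (tau : Type) (G : topologicalGroupType) : Type := G.

(** * The [tau]-modification is a topological group *)

Section tau_modification.
Variables (tau : Type) (G : topologicalGroupType).

Local Notation M := (tau_modification tau G).

Definition tau_nbhs (x : M) : set_system M :=
  [set A | exists2 O : tau -> set G,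
     forall i, nbhs (x : G) (O i) & \bigcap_i O i `<=` A].

HB.instance Definition _ := Group.copy M G.
HB.instance Definition _ := hasNbhs.Build M tau_nbhs.

Let tau_nbhs_singleton (x : M) (A : set M) : nbhs x A -> A x.
Proof. by move=> [O nO OA]; apply: OA => i _; exact: nbhs_singleton. Qed.

Let tau_nbhs_filter (x : M) : ProperFilter (nbhs x).
Proof.
apply: Build_ProperFilter_ex => [A nA|].
  by exists x; exact: tau_nbhs_singleton.
split.
- by exists (fun=> setT) => // i; exact: filterT.
(* Intersecting index by index keeps [tau] as the index type, without cardinal arithmetic. *)
- move=> A B [O nO OA] [P nP PB]; exists (fun i => O i `&` P i).
    by move=> i; exact: filterI.
  by move=> y OPy; split; [apply: OA|apply: PB] => i _; have [] := OPy i Logic.I.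
- by move=> A B AB [O nO OA]; exists O => // y /OA /AB.
Qed.

Let tau_nbhs_nbhs (x : M) (A : set M) : nbhs x A -> nbhs x (nbhs^~ A).
Proof.
(* The [O i] need not be open; their interiors are neighborhoods of each of their own points. *)
move=> [O nO OA]; exists (fun i => (O i)°).
  by move=> i; exact: nbhs_interior.
by move=> y Oy; exists O => // i; exact: Oy.
Qed.

HB.instance Definition _ := Nbhs_isNbhsTopological.Build M
  tau_nbhs_filter tau_nbhs_singleton tau_nbhs_nbhs.

Let tau_mul_continuous : continuous ((fun x => x.1 * x.2) : M * M -> M).
Proof.
move=> [x y] A [O nO OA].
have /choice[VW VWO] i : exists VW : set G * set G,
    [/\ nbhs (x : G) VW.1, nbhs (y : G) VW.2 &
        forall v w : G, VW.1 v -> VW.2 w -> O i (v * w)].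
  by have [V [W VWO]] := nbhs_mulg (nO i); exists (V, W).
exists (\bigcap_i (VW i).1, \bigcap_i (VW i).2) => /=.
  by split; [exists (fun i => (VW i).1)|exists (fun i => (VW i).2)] => // i;
    have [] := VWO i.
move=> [v w] /= [Vv Ww]; apply: OA => i _.
by have [_ _] := VWO i; apply; [exact: Vv|exact: Ww].
Qed.

Let tau_inv_continuous : continuous ((fun x => x^-1) : M -> M).
Proof.
move=> x A [O nO OA]; exists (fun i => [set y : G | O i y^-1]).
  by move=> i; exact: (@invg_continuous G x _ (nO i)).
by move=> y Oy; apply: OA.
Qed.

HB.instance Definition _ :=
  TopologicalGroup_axioms.Build M tau_mul_continuous tau_inv_continuous.

Lemma tau_modification_bigcap (x : M) (A : tau -> set G) :
  (forall i, nbhs (x : G) (A i)) -> nbhs x (\bigcap_i A i).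
Proof. by move=> nA; exists A. Qed.

Lemma tau_modification_continuous (i0 : tau) : continuous (fun x : M => x : G).
Proof. by move=> x A nA; exists (fun=> A) => // y Ay; exact: (Ay i0). Qed.

End tau_modification.

(** * Consequences of the universal property *)

Section free_group.
Variables (Omega : topologicalGroupType -> Prop).
Variables (X : uniformType) (F : topologicalGroupType) (i : X -> F).
Hypothesis F_free : free_topological_group Omega i.

(** Both [Phi] and the identity extend [i], and such an extension is unique. *)
Lemma free_group_endo_id (Phi : F -> F) :
  monoid_morphism Phi -> continuous Phi -> Phi \o i = i -> Phi = id.
Proof.
have [hF oF ui uF] := F_free; have [Psi [_ Psi_uniq]] := uF F hF oF i ui.
move=> mPhi cPhi Phii; rewrite -(Psi_uniq Phi) //.
by apply: Psi_uniq; split=> // x A; exact.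
Qed.

(** This is how [i] generates [F], with no description of its elements: [i] corestricts to [S] and
    extends to [F], and following the extension by the inclusion gives the identity, so every
    element lies in [S]. *)
Lemma free_group_subgroup (S : set F) (subS : subgroup S) :
  Omega (subgroup_type subS) -> (forall x, S (i x)) -> S = setT.
Proof.
have [hF oF ui uF] := F_free => oS Si.
pose j x : subgroup_type subS := exist _ (i x) (mem_set (Si x)).
have hS : hausdorff_space (subgroup_type subS).
  by apply: (injective_hausdorff (subgroup_val_continuous (subS := subS))).
have uj : unif_continuous (j : X -> two_sided (subgroup_type subS)).
  apply/two_sided_unif_continuousP => U /nbhs_subgroupP[V nV VU].
  have /two_sided_unif_continuousP/(_ _ nV) := ui.
  apply: filterS => xy [Vl Vr].
  by split; apply: VU; rewrite valM subgroup_valV.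
have [Phi [[mPhi cPhi Phij] _]] := uF _ hS oS j uj.
have e : (val : subgroup_type subS -> F) \o Phi = id.
  apply: free_group_endo_id.
  - exact: monoid_morphism_comp mPhi (subgroup_val_morphism subS).
  - exact: continuousT_comp cPhi (subgroup_val_continuous (subS := subS)).
  - by apply/funext => x /=; have /= -> := congr1 (@^~ x) Phij.
apply/seteqP; split=> // x _.
have -> : x = val (Phi x) by rewrite -[LHS]/(id x) -e.
exact/set_mem/(valP (Phi x)).
Qed.

Lemma free_group_tau_modification (tau : Type) :
  infinite_set [set: tau] ->
  (forall (I : Type) (E : I -> set (X * X)),
     [set: I] #<= [set: tau] -> (forall i, entourage (E i)) ->
     entourage (\bigcap_i E i)) ->
  Omega (tau_modification tau F) ->
  forall O : tau -> set F, (forall i, open (O i)) -> open (\bigcap_i O i).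
Proof.
have [hF oF ui uF] := F_free => tau_inf X_tau oM O openO.
have [t0 _] : [set: tau] !=set0 by exact: infinite_setN0.
pose toF (x : tau_modification tau F) : F := x.
have ctoF : continuous toF by exact: tau_modification_continuous.
have hM : hausdorff_space (tau_modification tau F).
  by apply: (injective_hausdorff ctoF).
pose j x : tau_modification tau F := i x.
have uj : unif_continuous (j : X -> two_sided (tau_modification tau F)).
  apply/two_sided_unif_continuousP => U [V nV VU].
  (* Each [V t] pulls back to an entourage of [X]; the hypothesis on [X] is applied to these [tau]
     many. *)
  have := X_tau tau _ (card_lexx _)
    (fun t => (two_sided_unif_continuousP i).1 ui _ (nV t)).
  by apply: filterS => xy Vxy; split; apply: VU => t _; have [] := Vxy t Logic.I.
have [Phi [[mPhi cPhi Phij] _]] := uF _ hM oM j uj.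
(* Pointwise [Phi] is the identity, so its continuity says that the topology of [F] refines its
   [tau]-modification. *)
have e : toF \o Phi = id.
  apply: free_group_endo_id => //.
  exact: continuousT_comp cPhi ctoF.
rewrite openE => x Ox.
have Phie y : Phi y = y by rewrite -[RHS]/(id y) -e.

have : nbhs x (Phi @^-1` \bigcap_t O t).
  apply: cPhi; apply: tau_modification_bigcap => t; rewrite Phie.
  by apply: open_nbhs_nbhs; split=> //; exact: Ox.
by apply: filterS => y; rewrite /= Phie.
Qed.

End free_group.

(** Each group lies in the class for which the other is free, so canonical maps exist both ways;
    their composites fix the generators and are identities. *)
Lemma same_free_group_of_free (OmegaF OmegaG : topologicalGroupType -> Prop)
    (X : uniformType) (F G : topologicalGroupType) (i : X -> F) (j : X -> G) :
  free_topological_group OmegaF i -> free_topological_group OmegaG j ->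
  OmegaF G -> OmegaG F -> same_free_group i j.
Proof.
move=> freeF freeG oFG oGF.
have [hF _ ui uF] := freeF; have [hG _ uj uG] := freeG.
have [Phi [[mPhi cPhi Phii] _]] := uF _ hG oFG j uj.
have [Psi [[mPsi cPsi Psij] _]] := uG _ hF oGF i ui.
have PsiPhi : Psi \o Phi = id.
  apply: (free_group_endo_id freeF); first exact: monoid_morphism_comp.
    exact: continuousT_comp.
  by rewrite -compA Phii.
have PhiPsi : Phi \o Psi = id.
  apply: (free_group_endo_id freeG); first exact: monoid_morphism_comp.
    exact: continuousT_comp.
  by rewrite -compA Psij.
exists Phi; split=> //; split=> //; exists Psi; split=> // x.
- exact: (congr1 (@^~ x) PsiPhi).
- exact: (congr1 (@^~ x) PhiPsi).
Qed.

Lemma same_free_group_sym (X : uniformType) (F G : topologicalGroupType)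
    (i : X -> F) (j : X -> G) : same_free_group i j -> same_free_group j i.
Proof.
move=> [Phi [[mPhi cPhi [Psi [PhiK PsiK cPsi]]] Phii]].
exists Psi; split; last by apply/funext => x; rewrite /= -Phii /= PhiK.
split=> //; last by exists Phi.
split=> [|x y]; first by rewrite -mPhi.1 PhiK.
by rewrite -{1}(PsiK x) -{1}(PsiK y) -mPhi.2 PhiK.
Qed.

Lemma same_free_group_trans (X : uniformType) (F G H : topologicalGroupType)
    (i : X -> F) (j : X -> G) (k : X -> H) :
  same_free_group i j -> same_free_group j k -> same_free_group i k.
Proof.
move=> [Phi [[mPhi cPhi [Phi' [PhiK PhiK' cPhi']]] Phii]].
move=> [Psi [[mPsi cPsi [Psi' [PsiK PsiK' cPsi']]] Psij]].
exists (Psi \o Phi); split; last by rewrite -compA Phii.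
split; first exact: monoid_morphism_comp.
  exact: continuousT_comp.
exists (Phi' \o Psi'); split; [exact: can_comp|exact: can_comp|].
exact: continuousT_comp.
Qed.

(** * Narrowness and invariant subgroups *)

Section narrow_balanced.
Variables (tau : Type) (X : uniformType) (F : topologicalGroupType).
Variable i : X -> F.
Hypothesis i_unif : unif_continuous (i : X -> two_sided F).
Hypothesis narrowX : cardinal_narrow tau X.
Hypothesis bigcapF :
  forall O : tau -> set F, (forall t, open (O t)) -> open (\bigcap_t O t).

(** Inverses of generators are included so that, after iteration, each generator conjugates the
    intersection onto itself and not merely into itself. *)
Definition generator_core (H : set F) : set F :=
  H `&` [set g | forall x, H (i x * g * (i x)^-1) /\ H ((i x)^-1 * g * i x)].

Lemma subgroup_generator_core (H : set F) :
  subgroup H -> subgroup (generator_core H).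
Proof.
move=> sH; split.
  by split=> [|x]; [exact: sH.1|rewrite !mulg1 mulgV mulVg; split; exact: sH.1].
move=> g h [Hg Cg] [Hh Ch]; split=> [|x]; first exact: sH.2.
have [Cg1 Cg2] := Cg x; have [Ch1 Ch2] := Ch x; split.
  by have := sH.2 _ _ Cg1 Ch1; rewrite !invgM !invgK !mulgA divgK.
by have := sH.2 _ _ Cg2 Ch2; rewrite !invgM !invgK !mulgA mulgK.
Qed.

(* If [i x] and [i y] agree modulo [H] on both sides, then they conjugate the
   subgroup [H] in the same way, so [tau] many conjugates suffice. *)
Lemma nbhs_generator_core (H : set F) :
  subgroup H -> nbhs (1 : F) H -> nbhs (1 : F) (generator_core H).
Proof.
move=> sH nH.
(* The entourage is the one that [H] itself induces on [X] through [i]. *)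
have [x xE] := narrowX ((two_sided_unif_continuousP i).1 i_unif _ nH).
have nC : nbhs (1 : F) (\bigcap_t [set g |
    H (i (x t) * g * (i (x t))^-1) /\ H ((i (x t))^-1 * g * i (x t))]).
  apply: nbhs_bigcap => // t; apply: filterI; first exact: nbhs1_conj.
  by have := nbhs1_conj (i (x t))^-1 nH; rewrite invgK.
apply: filterS (filterI nH nC) => g [Hg Cg]; split=> // y.
have : [set: X] y by [].
rewrite xE => -[t _ /xsectionP[/= Hl Hr]].
have [C1 C2] := Cg t Logic.I; split.
  (* With [r = i (x t) * (i y)^-1] in [H], the conjugate of [g] by [i y] is [r^-1 * c * r], where
     [c] is its conjugate by [i (x t)]. *)
  have := subgroupM sH (subgroupM sH (subgroupV sH Hr) C1) Hr.
  by rewrite invgM invgK !mulgA !divgK.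
have := subgroupM sH (subgroupM sH (subgroupV sH Hl) C2) Hl.
by rewrite invgM invgK !mulgA !mulgK.
Qed.

End narrow_balanced.

Lemma narrow_free_group_balanced (tau : Type) (X : uniformType)
    (F : topologicalGroupType) (i : X -> F) :
  uniform_free_group i -> cardinal_narrow tau X ->
  (forall O : tau -> set F, (forall t, open (O t)) -> open (\bigcap_t O t)) ->
  P_group F -> balanced F.
Proof.
move=> freeF narrowX bigcapF PF; have [hF _ ui _] := freeF.
apply: normal_balanced => U /(P_group_nonarchimedean PF)[H [oH cH HU]].
have sH := closed_subgroup cH.
pose D n := iter n (generator_core i) H.
have sD n : subgroup (D n) by elim: n => //= n; exact: subgroup_generator_core.
have nD n : nbhs (1 : F) (D n).
  elim: n => [|n nDn]; first by apply: open_nbhs_nbhs; split=> //; exact: sH.1.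
  exact: (nbhs_generator_core ui narrowX bigcapF).
pose K := \bigcap_n D n.
(* [M] is the normalizer of [K]. It contains the generators, since [D n.+1] is conjugated by them
   into [D n]; being a subgroup, it is then all of [F]. *)
pose M := [set m | forall g, K g -> K (m * g * m^-1) /\ K (m^-1 * g * m)].
have sM : subgroup M.
  split=> [g Kg|m n Mm Mn g Kg]; first by rewrite invg1 !mul1g !mulg1.
  have [Kn1 Kn2] := Mn g Kg; have [Km1 Km2] := Mm g Kg.
  have [L1 _] := Mm _ Kn2; have [L2 _] := Mn _ Km2.
  by rewrite invgM invgK !mulgA in L1 L2 *.
have Mi x : M (i x).
  move=> g Kg; split=> n _; have [_ /(_ x)[]] := Kg n.+1 Logic.I; exact.
exists K; split.
- exact: nbhs_bigcap.
- by move=> g Kg; apply: HU; exact: (Kg 0%N).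
- move=> g m Kg; have : M m by rewrite (free_group_subgroup freeF (subS := sM)).
  by move=> /(_ g Kg)[].
Qed.

Theorem theorem3p7 (X : uniformType) (X_hausdorff : hausdorff_space X)
    (X_nonempty : [set: X] !=set0)
    (tau : Type) (tau_infinite : infinite_set [set: tau])
    (X_tau : forall (I : Type) (E : I -> set (X * X)),
       [set: I] #<= [set: tau] -> (forall i, entourage (E i)) ->
       entourage (\bigcap_i E i))
    (F : topologicalGroupType) (iF : X -> F)
    (F_free : uniform_free_group iF) :
  [/\ forall (I : Type) (O : I -> set F),
         [set: I] #<= [set: tau] -> (forall i, open (O i)) ->
         open (\bigcap_i O i),
      P_group F &
      forall (N : topologicalGroupType) (iN : X -> N),
        free_nonarchimedean_group iN -> same_free_group iF iN] /\
  (cardinal_narrow tau X ->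
   forall (N : topologicalGroupType) (iN : X -> N)
          (B : topologicalGroupType) (iB : X -> B),
     free_nonarchimedean_group iN ->
     free_nonarchimedean_balanced_group iB ->
     same_free_group iF iN /\ same_free_group iN iB).
Proof.
have capF : forall O : tau -> set F,
    (forall t, open (O t)) -> open (\bigcap_t O t).
  by apply: (@free_group_tau_modification (fun=> True) X F iF F_free).
have PF : P_group F.
  (* An infinite [tau] admits an injection from [nat]. *)
  by move=> O; apply: (open_bigcap_card_le capF); apply/infiniteP.
have NF := P_group_nonarchimedean PF.
have FN (N : topologicalGroupType) (iN : X -> N) :
    free_nonarchimedean_group iN -> same_free_group iF iN.
  by move=> freeN; exact: (same_free_group_of_free F_free freeN).
split; first by split=> // I O; exact: open_bigcap_card_le.
move=> narrowX N iN B iB freeN freeB.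
have BF := narrow_free_group_balanced F_free narrowX capF PF.
split; first exact: FN.
(* The comparison of [N] with [B] passes through [F], which is now known to be both non-archimedean
   and balanced. *)
apply: same_free_group_trans (same_free_group_sym (FN N iN freeN)) _.
exact: (same_free_group_of_free F_free freeB).
Qed.
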